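(* Let $n,x,k$ be integers with $n-1>x\ge k\ge 1$, $x<2k$ and $F_n(x,k)>0$. Then $$F_n(x,k)=2\binom{n-k-1}{x-k}+(n-k-1)\binom{n-k-2}{x-k}.$$
   Context: For integers $n,x,k\ge 0$, $B_n^{x,k}$ denotes the set of binary strings of length $n$ that contain exactly $x$ zeros and in which the longest block of consecutive zeros has length exactly $k$. $F_n(x,k)=|B_n^{x,k}|$. *)

(* Defs.v *)
From mathcomp Require Import all_boot.

Set Implicit Arguments.
Unset Strict Implicit.
Unset Printing Implicit Defensive.

(* In a binary string the bit [false] is the digit 0 and [true] the digit 1. *)

Definition longest_zero_block (s : seq bool) : nat :=
  \max_(l < (size s).+1 | infix (nseq l false) s) l.

Definition B (n x k : nat) : {set n.-tuple bool} :=
  [set s : n.-tuple bool |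
     (count_mem false s == x) && (longest_zero_block s == k)].

Definition F (n x k : nat) : nat := #|B n x k|.

(* Main.v *)
(** Since [x < 2k], a string of [B n x k] has exactly one maximal run of [k]
    zeros, and conversely a string with [x] zeros and a maximal run of [k] zeros
    has no longer run. So [F n x k] is the number of pairs formed by a string with
    [x] zeros and the starting position of a maximal run of length [k] in it.
    Removing the run with its delimiting ones leaves an arbitrary string with
    [x - k] zeros: of length [n-k-1] if the run is at one of the two ends, and of
    length [n-k-2] for each of the [n-k-1] inner positions. *)
Require Import Defs.
From mathcomp Require Import all_boot zify.

Set Implicit Arguments.
Unset Strict Implicit.

(* Reading outside a string gives [true], so both ends of a string delimit runs. *)
Definition zeros_at (s : seq bool) (i k : nat) : bool :=
  [forall j : 'I_k, ~~ nth true s (i + j)].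

Definition maximal_run_at (s : seq bool) (i k : nat) : bool :=
  [&& (i == 0) || nth true s i.-1, zeros_at s i k & nth true s (i + k)].

Lemma zeros_atP s i k :
  reflect (forall j, j < k -> nth true s (i + j) = false) (zeros_at s i k).
Proof.
apply: (iffP forallP) => [h j jk|h j]; last by rewrite h.
by have /negbTE := h (Ordinal jk).
Qed.

(** The last position of the block reads [false], while every position past the end reads [true].
    With [k = 0] nothing would bound [i]. *)
Lemma zeros_at_size s i k : 0 < k -> zeros_at s i k -> i + k <= size s.
Proof.
case: k => // k _ /zeros_atP /(_ k (ltnSn k)) h.
rewrite addnS ltnNge; apply/negP => /(nth_default true).
by rewrite h.
Qed.

Lemma take_zeros_at s i k : zeros_at s i k -> take k (drop i s) = nseq k false.
Proof.
case: k => [|k] h; first by rewrite take0.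
have sz := zeros_at_size (isT : 0 < k.+1) h.
have szt : size (take k.+1 (drop i s)) = k.+1.
  by rewrite size_takel // size_drop; lia.
apply: (@eq_from_nth _ true) => [|j]; rewrite szt ?size_nseq // => jk.
by rewrite nth_take // nth_drop nth_nseq jk; move/zeros_atP: h => ->.
Qed.

Lemma infix_zerosP s k :
  0 < k -> reflect (exists i, zeros_at s i k) (infix (nseq k false) s).
Proof.
move=> k0; apply: (iffP (@infixP _ _ _)) => [[p [q ->]]|[i h]].
  exists (size p); apply/zeros_atP => j jk.
  by rewrite nth_cat ltnNge leq_addr addKn nth_cat size_nseq jk nth_nseq jk.
exists (take i s), (drop k (drop i s)).
by rewrite -(take_zeros_at h) !cat_take_drop.
Qed.

(** A block of zeros contains blocks of all shorter lengths, so the maximum decides which lengths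
    occur. *)
Lemma infix_longest s l :
  infix (nseq l false) s = (l <= longest_zero_block s).
Proof.
rewrite /longest_zero_block; apply/idP/idP => [h|].
  have ls : l < (size s).+1 by have := size_infix h; rewrite size_nseq ltnS.
  exact: (leq_bigmax_cond (F := fun i : 'I__ => i : nat) (Ordinal ls) h).
(* The empty block makes the index set nonempty, so the maximum is attained. *)
have P0 : 0 < #|[pred i : 'I_(size s).+1 | infix (nseq i false) s]|.
  by apply/card_gt0P; exists ord0; rewrite inE infix0s.
have [i hi ->] := eq_bigmax_cond (fun i : 'I__ => i : nat) P0.
move=> li; apply: (infix_trans _ hi).
by rewrite -(subnKC li) nseqD; apply/infixP; exists [::], (nseq (i - l) false).
Qed.

Lemma zeros_at_count s i k : zeros_at s i k -> k <= count_mem false s.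
Proof.
move=> /take_zeros_at h.
have sub : subseq (take k (drop i s)) s.
  exact: subseq_trans (take_subseq _ _) (drop_subseq _ _).
by have := leq_count_subseq (pred1 false) sub;
  rewrite h count_nseq mul1n.
Qed.

(** Cutting [s] at [j] puts one block into each piece. *)
Lemma disjoint_zeros_count s i j k l : i + k <= j ->
  zeros_at s i k -> zeros_at s j l -> k + l <= count_mem false s.
Proof.
move=> ij /zeros_atP hi /zeros_atP hj.
rewrite -(cat_take_drop j s) count_cat leq_add //.
  apply: (@zeros_at_count _ i); apply/zeros_atP => t tk.
  by rewrite nth_take ?hi //; lia.
apply: (@zeros_at_count _ 0); apply/zeros_atP => t tl.
by rewrite nth_drop add0n hj.
Qed.

(** A block at least as long as a maximal run and different from it cannot overlap it: it would
    cover one of the delimiting ones. *)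
Lemma maximal_run_disjoint s i j k l :
  maximal_run_at s i k -> zeros_at s j l -> 0 < k -> k <= l ->
  ~~ ((i == j) && (k == l)) -> k + l <= count_mem false s.
Proof.
move=> /and3P[hl hi hr] hj k0 kl neq.
have [|ij] := leqP (i + k) j.
  by move=> ij; apply: disjoint_zeros_count ij hi hj.
have [ji|ji] := leqP (j + l) i.
  by rewrite addnC; apply: disjoint_zeros_count ji hj hi.
exfalso; have /zeros_atP h := hj.
have [jk|jk] := ltnP (i + k) (j + l).
  have := h (i + k - j); rewrite subnKC; last by lia.
  by rewrite hr => H; suff: true = false by []; apply: H; lia.
(* Here the block ends no later than the run; being at least as long, it coincides with the run or
   covers the one at [i.-1]. *)
case/orP: hl => [/eqP i0|hl]; first by move: neq; lia.
have [ij'|ij'] := ltnP j i; last by move: neq; lia.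
have := h (i.-1 - j); rewrite subnKC; last by lia.
by rewrite hl => H; suff: true = false by []; apply: H; lia.
Qed.

(** A zero next to a longest block would extend it to [k.+1] zeros. *)
Lemma longest_maximal_run s k : 0 < k ->
  longest_zero_block s = k -> exists i, maximal_run_at s i k.
Proof.
move=> k0 hs; have: infix (nseq k false) s by rewrite infix_longest hs.
move=> /(infix_zerosP _ k0)[i h]; exists i; rewrite /maximal_run_at h /=.
have no j : ~~ zeros_at s j k.+1.
  apply: contraFN (ltnn k) => hj.
  by rewrite -[X in _ < X]hs -infix_longest; apply/infix_zerosP => //; exists j.
move/zeros_atP: h => h; apply/andP; split.
  case: i h => //= i h; apply: contraNT (no i) => hi.
  apply/zeros_atP => -[|j] jk; first by rewrite addn0; apply/negbTE.
  by rewrite addnS -addSn h.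
apply: contraNT (no i) => hi; apply/zeros_atP => j.
rewrite ltnS leq_eqVlt => /orP[/eqP->|]; last exact: h.
exact/negbTE.
Qed.

(** A block of [k.+1] zeros would be disjoint from the run, giving [2 * k + 1] zeros in all. *)
Lemma maximal_run_longest s i k : 0 < k -> count_mem false s < 2 * k ->
  maximal_run_at s i k -> longest_zero_block s = k.
Proof.
move=> k0 hc hr; apply/eqP; rewrite eqn_leq -infix_longest andbC.
have hz : zeros_at s i k by case/and3P: hr.
rewrite (introT (infix_zerosP s k0)) /=; last by exists i.
rewrite leqNgt -infix_longest; apply/negP => /infix_zerosP[//|j hj].
by have := maximal_run_disjoint hr hj k0 (leqnSn k); lia.
Qed.

(** The sum is at most 1, since two maximal runs of length [k] would use [2 * k] zeros. This
    prepares the double counting over start positions. *)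
Lemma maximal_run_sum n k (s : n.-tuple bool) :
  0 < k -> count_mem false s < 2 * k ->
  (longest_zero_block s == k : nat) =
    \sum_(i < (n - k).+1) maximal_run_at s i k.
Proof.
move=> k0 hc; have [/eqP hs|hs] := boolP (_ == _); last first.
  rewrite big1 // => i _; apply/eqP; rewrite eqb0.
  apply: contraNN hs => hr; apply/eqP; exact: maximal_run_longest k0 hc hr.
have [i hr] := longest_maximal_run k0 hs.
have hz : zeros_at s i k by case/and3P: hr.
have ik : i < (n - k).+1 by have := zeros_at_size k0 hz; rewrite size_tuple; lia.
rewrite (bigD1 (Ordinal ik)) //= hr big1 // => j.
rewrite -val_eqE /= => ij; apply/eqP; rewrite eqb0; apply/negP => hj.
have hz' : zeros_at s j k by case/and3P: hj.
by have := maximal_run_disjoint hr hz' k0 (leqnn k); move: ij hc; lia.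
Qed.

Lemma count_mem_card (m : nat) (a : bool) (t : m.-tuple bool) :
  count_mem a t = #|[set j : 'I_m | tnth t j == a]|.
Proof.
by rewrite -sum1_count big_tuple -sum1_card; apply: eq_bigl => j; rewrite !inE.
Qed.

(** A binary string is determined by the set of positions of the letter [a]. *)
Lemma card_tuple_count (m y : nat) (a : bool) :
  #|[set t : m.-tuple bool | count_mem a t == y]| = 'C(m, y).
Proof.
rewrite -[in RHS](card_ord m) -card_draws.
pose f (t : m.-tuple bool) := [set j : 'I_m | tnth t j == a].
have f_inj : injective f.
  move=> t u /setP tu; apply: eq_from_tnth => j.
  by have := tu j; rewrite !inE; clear; move: (tnth t j) (tnth u j) a => [] [] [].
rewrite -(card_imset _ f_inj); apply: eq_card => A; apply/imsetP/idP.
  by move=> [t]; rewrite !inE count_mem_card => h ->.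
rewrite inE => hA.
have fA : A = f [tuple if j \in A then a else ~~ a | j < m].
  by apply/setP => j; rewrite inE tnth_mktuple; clear; move: (j \in A) a => [] [].
by exists [tuple if j \in A then a else ~~ a | j < m];
   rewrite // inE count_mem_card -/(f _) -fA.
Qed.

(** Inserting [p] at position [o] is a bijection from the strings of length [m] with
    [x - count_mem a p] letters [a]. *)
Lemma card_tuple_prefix_count (m o x : nat) (a : bool) (p : seq bool) :
  o <= m -> count_mem a p <= x ->
  #|[set s : (m + size p).-tuple bool |
       (count_mem a s == x) && prefix p (drop o s)]|
    = 'C(m, x - count_mem a p).
Proof.
move=> om px; rewrite -(card_tuple_count _ _ a).
pose g (t : seq bool) := take o t ++ p ++ drop o t.
have szg (t : m.-tuple bool) : size (g t) == m + size p.
  by rewrite !size_cat addnCA -size_cat cat_take_drop size_tuple addnC.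
pose f (t : m.-tuple bool) := Tuple (szg t).
have szo (t : m.-tuple bool) : size (take o t) = o.
  by rewrite size_takel // size_tuple.
have f_inj : injective f.
  move=> t u /(congr1 val) /= /eqP; rewrite eqseq_cat ?szo //.
  case/andP=> /eqP tu; rewrite eqseq_cat // => /andP[_ /eqP du].
  by apply: val_inj; rewrite /= -(cat_take_drop o t) tu du cat_take_drop.
have cg (t : seq bool) : count_mem a (g t) = count_mem a p + count_mem a t.
  by rewrite !count_cat addnCA -[X in _ + X]count_cat cat_take_drop.
rewrite -(card_imset _ f_inj); apply: eq_card => s; apply/idP/imsetP.
  rewrite inE => /andP[/eqP cs /prefixP[q hq]].
  have szs := size_tuple s.
  have szo' : size (take o s) = o by rewrite size_takel // szs; lia.
  have szt : size (take o s ++ q) == m.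
    have := congr1 size hq; rewrite size_drop !size_cat szs szo'.
    by rewrite [m + _]addnC -addnBA // => /addnI <-; rewrite subnKC.
  have gs : val s = g (take o s ++ q).
    by rewrite /g take_size_cat // drop_size_cat // -hq cat_take_drop.
  exists (Tuple szt); last exact: val_inj.
  by have := cg (take o s ++ q); rewrite -gs cs inE => ->; rewrite addKn.
move=> [t]; rewrite inE => /eqP ct ->; rewrite inE /= cg ct subnKC // eqxx /=.
by rewrite /g drop_size_cat ?szo // prefix_prefix.
Qed.

Lemma prefix_zeros (s q : seq bool) o k : o + (k + size q) <= size s ->
  prefix (nseq k false ++ q) (drop o s) =
    zeros_at s o k && prefix q (drop (o + k) s).
Proof.
move=> sz; have szk : k <= size (drop o s) by rewrite size_drop; lia.
rewrite prefixE size_cat size_nseq -[X in take _ X](cat_take_drop k).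
rewrite take_cat size_takel // ltnNge leq_addr addKn /=.
rewrite eqseq_cat ?size_takel ?size_nseq // drop_drop addnC prefixE.
congr (_ && _).
apply/eqP/idP => [h|/take_zeros_at //].
by apply/zeros_atP => j jk; rewrite -nth_drop -(nth_take _ jk) h nth_nseq jk.
Qed.

Lemma prefix1_drop (s : seq bool) o b q : o < size s ->
  prefix (b :: q) (drop o s) = (nth true s o == b) && prefix q (drop o.+1 s).
Proof. by move=> os; rewrite (drop_nth true) //= eq_sym. Qed.

Unset Implicit Arguments.
Set Strict Implicit.

Theorem theorem3p1 (n x k : nat) (hxn : n - 1 > x) (hkx : x >= k)
  (hk : k >= 1) (hx2k : x < 2 * k) (hF : F n x k > 0) :
  F n x k =
    2 * 'C(n - k - 1, x - k) + (n - k - 1) * 'C(n - k - 2, x - k).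
Proof.
(* [m] is the number of letters left once an inner run and its two delimiters are removed. *)
have [m en] : exists m, n = m.+2 + k by exists (n - k - 2); lia.
have -> : n - k - 1 = m.+1 by lia.
have -> : n - k - 2 = m by lia.
have -> : F n x k = \sum_(i < (n - k).+1)
    #|[set s : n.-tuple bool | (count_mem false s == x) && maximal_run_at s i k]|.
  transitivity (\sum_(s : n.-tuple bool | count_mem false s == x)
                  \sum_(i < (n - k).+1) (maximal_run_at s i k : nat)).
    rewrite /F -sum1_card (eq_bigl _ _ (fun s => in_set _ s)) big_mkcondr /=.
    apply: eq_bigr => s /eqP sx; rewrite -maximal_run_sum ?sx //.
  rewrite exchange_big /=; apply: eq_bigr => i _.
  rewrite -sum1_card (eq_bigl _ _ (fun s => in_set _ s)) [RHS]big_mkcondr /=.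
  by apply: eq_bigr => s _; case: maximal_run_at.
have cz : count_mem false (nseq k false) = k by rewrite count_nseq mul1n.
have -> : n - k = m.+2 by lia.
(* Isolates the start positions [0] and [m.+2], the two ends of the string; [m.+1] inner positions
   remain. *)
rewrite big_ord_recl big_ord_recr /=.
(* [p] will be the run together with its delimiters inside the string, and [o] the position where
   [p] starts. *)
have count_at o (p : seq bool) (Q : seq bool -> bool) : o + size p <= n ->
    count_mem false p = k ->
    (forall s, size s = n -> Q s = prefix p (drop o s)) ->
    #|[set s : n.-tuple bool | (count_mem false s == x) && Q s]|
      = 'C(n - size p, x - k).
  move=> op cp hQ; have np : n = n - size p + size p by lia.
  rewrite -cp -(@card_tuple_prefix_count _ o) ?cp //; last by lia.
  rewrite -np; apply: eq_card => s; rewrite !inE hQ ?size_tuple //.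
rewrite (count_at 0 (nseq k false ++ [:: true])
           (fun s => maximal_run_at s 0 k)); first last.
- move=> s sz; rewrite /maximal_run_at prefix_zeros /=; last by lia.
  by rewrite prefix1_drop ?prefix0s ?eqb_id ?andbT //; lia.
- by rewrite count_cat cz; apply: addn0.
- by rewrite size_cat size_nseq /=; lia.
(* The right delimiter of a final run is the default [true] past the end, so only the left one
   belongs to the word; [++ [::]] gives the shape that [prefix_zeros] expects. *)
rewrite (count_at m.+1 (true :: nseq k false ++ [::])
           (fun s => maximal_run_at s m.+2 k)); first last.
- move=> s sz; rewrite prefix1_drop ?prefix_zeros /=; try lia.
  rewrite prefix0s andbT /maximal_run_at /bump /= eqb_id.
  by rewrite [nth _ _ (_ + _)]nth_default ?andbT //; lia.
- by rewrite cats0 /= cz.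
- by rewrite cats0 /= size_nseq; lia.
(* An inner run is removed with both ones, [k + 2] letters, wherever it starts. *)
rewrite (eq_bigr (fun _ => 'C(m, x - k))); last first.
  move=> i _; rewrite (count_at i (true :: nseq k false ++ [:: true])
           (fun s => maximal_run_at s i.+1 k)).
  - by rewrite /= size_cat size_nseq /=; congr 'C(_, _); lia.
  - by have := ltn_ord i; rewrite /= size_cat size_nseq /=; lia.
  - by rewrite -cat_cons count_cat /= cz; apply: addn0.
  - move=> s sz; have := ltn_ord i => im.
    rewrite prefix1_drop ?prefix_zeros /=; try lia.
    rewrite prefix1_drop ?prefix0s ?eqb_id ?andbT; last by lia.
    by rewrite /maximal_run_at /bump /=.
rewrite sum_nat_const card_ord !size_cat /= size_cat !size_nseq /=.
have -> : n - (k + 1) = m.+1 by lia.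
have -> : n - (k + 0).+1 = m.+1 by lia.
lia.
Qed.
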